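(* The isometry group $\mathrm{Isom}(\mathbb{U})$ of the Urysohn space $\mathbb{U}$ admits no non-trivial continuous representation by isometries on a reflexive Banach space; that is, for every reflexive Banach space $E$, every continuous homomorphism $\mathrm{Isom}(\mathbb{U})\to\mathrm{Isom}(E)$ is trivial.
   Context: The Urysohn space $\mathbb{U}$ is the unique complete separable metric space which is universal (every separable metric space embeds isometrically into $\mathbb{U}$) and ultrahomogeneous (every isometry between finite subspaces extends to an isometry of $\mathbb{U}$ onto itself). $\mathrm{Isom}(\mathbb{U})$ is the Polish group of isometries of $\mathbb{U}$ onto itself, with the topology of pointwise convergence, where $\mathbb{U}$ carries its metric topology. For a Banach space $E$, $\mathrm{Isom}(E)$ is the group of linear isometries of $E$ onto itself, with the topology of pointwise convergence ($E$ carrying its norm topology). $E$ is reflexive if the canonical evaluation map $E\to E^{**}$ is a homeomorphism. *)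

(* Defs.v *)
From HB Require Import structures.
From mathcomp Require Import all_boot all_order all_algebra.
From mathcomp Require Import all_classical all_reals all_analysis.

Set Implicit Arguments.
Unset Strict Implicit.
Unset Printing Implicit Defensive.

Import Order.TTheory GRing.Theory Num.Theory.
Import numFieldNormedType.Exports.

Local Open Scope classical_set_scope.
Local Open Scope ring_scope.

Definition separable (T : topologicalType) : Prop :=
  exists2 D : set T, countable D & dense D.

(* [completeType] would also ask for a point, which a metric space need not
   have; hence the limit is given by an explicit existential. *)
Definition complete_metric (R : realType) (M : metricType R) : Prop :=
  forall F : set_system M, ProperFilter F -> cauchy F -> exists l : M, F --> l.

Definition isometric (R : realType) (M N : metricType R) (f : M -> N) : Prop :=
  forall x y : M, mdist (f x) (f y) = mdist x y.

Section Isom.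
Variables (R : realType) (M : metricType R).

Definition isom_pred : pred (M -> M) :=
  fun f => `[< isometric f /\ set_surj [set: M] [set: M] f >].

Record isom := Isom { isom_fun :> M -> M; isom_funP : isom_pred isom_fun }.

HB.instance Definition _ := [isSub for isom_fun].
HB.instance Definition _ := [Choice of isom by <:].

Implicit Types f g h : isom.

Lemma isom_isometric f : isometric f.
Proof. by case: f => f /= /asboolP[]. Qed.

Lemma isom_surj f (y : M) : exists x, f x = y.
Proof.
by case: f => f /= /asboolP[_ /(_ y I)] [x _ <-]; exists x.
Qed.

Lemma isom_inj f : injective f.
Proof.
move=> x y fxy; apply: mdist_positivity.
by rewrite -(isom_isometric f) fxy mdistxx.
Qed.

Lemma isom_ext f g : f =1 g -> f = g.
Proof. by move=> fg; apply/val_inj/funext. Qed.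

Definition isom_inv_fun f (y : M) : M := sval (cid (isom_surj f y)).

Lemma isom_inv_funK f : cancel (isom_inv_fun f) f.
Proof. by move=> y; rewrite /isom_inv_fun; case: cid. Qed.

Lemma isom_funK f : cancel f (isom_inv_fun f).
Proof. by move=> x; apply: (@isom_inj f); rewrite isom_inv_funK. Qed.

Lemma isom_one_subproof : isom_pred id.
Proof. by apply/asboolP; split=> // y _; exists y. Qed.

Lemma isom_mul_subproof f g : isom_pred (f \o g).
Proof.
apply/asboolP; split; first by move=> x y /=; rewrite !isom_isometric.
move=> z _; have [y fy] := isom_surj f z; have [x gx] := isom_surj g y.
by exists x => //=; rewrite gx fy.
Qed.

Lemma isom_inv_subproof f : isom_pred (isom_inv_fun f).
Proof.
apply/asboolP; split; last by move=> x _; exists (f x) => //; exact: isom_funK.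
by move=> x y; rewrite -(isom_isometric f) !isom_inv_funK.
Qed.

Definition isom_one : isom := Isom isom_one_subproof.
Definition isom_mul f g : isom := Isom (isom_mul_subproof f g).
Definition isom_inv f : isom := Isom (isom_inv_subproof f).

Lemma isom_mulA : associative isom_mul.
Proof. by move=> f g h; apply: isom_ext. Qed.
Lemma isom_mul1 : left_id isom_one isom_mul.
Proof. by move=> f; apply: isom_ext. Qed.
Lemma isom_1mul : right_id isom_one isom_mul.
Proof. by move=> f; apply: isom_ext. Qed.
Lemma isom_mulV : left_inverse isom_one isom_inv isom_mul.
Proof. by move=> f; apply: isom_ext => x /=; exact: isom_funK. Qed.
Lemma isom_Vmul : right_inverse isom_one isom_inv isom_mul.
Proof. by move=> f; apply: isom_ext => x /=; exact: isom_inv_funK. Qed.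

HB.instance Definition _ := isGroup.Build isom
  isom_mulA isom_mul1 isom_1mul isom_mulV isom_Vmul.

HB.instance Definition _ := Topological.copy isom
  (initial_topology (isom_fun : isom -> {ptws M -> M})).

End Isom.

Definition universal_metric (R : realType) (U : metricType R) : Prop :=
  forall M : metricType R, separable M -> exists f : M -> U, isometric f.

(* A partial isometry between finite subspaces A and B is carried by a total
   function of which only the values on A matter. *)
Definition ultrahomogeneous (R : realType) (U : metricType R) : Prop :=
  forall (A B : set U) (f : U -> U), finite_set A -> finite_set B ->
    set_bij A B f ->
    (forall x y, A x -> A y -> mdist (f x) (f y) = mdist x y) ->
    exists g : isom U, forall x, A x -> g x = f x.

Definition urysohn (R : realType) (U : metricType R) : Prop :=
  [/\ complete_metric U, separable U, universal_metric U & ultrahomogeneous U].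

Section LinIsom.
Variables (R : realType) (E : normedModType R).

Definition linisom_pred : pred (E -> E) := fun f =>
  `[< [/\ linear f, (forall x : E, `|f x| = `|x|)
        & set_surj [set: E] [set: E] f] >].

Record linisom :=
  LinIsom { linisom_fun :> E -> E; linisom_funP : linisom_pred linisom_fun }.

HB.instance Definition _ := [isSub for linisom_fun].
HB.instance Definition _ := [Choice of linisom by <:].

Implicit Types f g h : linisom.

Lemma linisom_linear f : linear f.
Proof. by case: f => f /= /asboolP[]. Qed.

Lemma linisom_norm f (x : E) : `|f x| = `|x|.
Proof. by case: f => f /= /asboolP[]. Qed.

Lemma linisom_surj f (y : E) : exists x, f x = y.
Proof.
by case: f => f /= /asboolP[_ _ /(_ y I)] [x _ <-]; exists x.
Qed.

Lemma linisom_inj f : injective f.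
Proof.
move=> x y fxy; apply/eqP; rewrite -subr_eq0 -normr_eq0 -(linisom_norm f).
rewrite (_ : x - y = (-1) *: y + x) ?scaleN1r 1?addrC//.
by rewrite -scaleN1r addrC linisom_linear fxy scaleN1r addNr normr0.
Qed.

Lemma linisom_ext f g : f =1 g -> f = g.
Proof. by move=> fg; apply/val_inj/funext. Qed.

Definition linisom_inv_fun f (y : E) : E := sval (cid (linisom_surj f y)).

Lemma linisom_inv_funK f : cancel (linisom_inv_fun f) f.
Proof. by move=> y; rewrite /linisom_inv_fun; case: cid. Qed.

Lemma linisom_funK f : cancel f (linisom_inv_fun f).
Proof. by move=> x; apply: (@linisom_inj f); rewrite linisom_inv_funK. Qed.

Lemma linisom_one_subproof : linisom_pred id.
Proof. by apply/asboolP; split=> // y _; exists y. Qed.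

Lemma linisom_mul_subproof f g : linisom_pred (f \o g).
Proof.
apply/asboolP; split.
- by move=> a x y /=; rewrite !linisom_linear.
- by move=> x /=; rewrite !linisom_norm.
move=> z _; have [y fy] := linisom_surj f z; have [x gx] := linisom_surj g y.
by exists x => //=; rewrite gx fy.
Qed.

Lemma linisom_inv_subproof f : linisom_pred (linisom_inv_fun f).
Proof.
apply/asboolP; split.
- move=> a x y; apply: (@linisom_inj f).
  by rewrite linisom_linear !linisom_inv_funK.
- by move=> x; rewrite -(linisom_norm f) linisom_inv_funK.
by move=> x _; exists (f x) => //; exact: linisom_funK.
Qed.

Definition linisom_one : linisom := LinIsom linisom_one_subproof.
Definition linisom_mul f g : linisom := LinIsom (linisom_mul_subproof f g).
Definition linisom_inv f : linisom := LinIsom (linisom_inv_subproof f).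

Lemma linisom_mulA : associative linisom_mul.
Proof. by move=> f g h; apply: linisom_ext. Qed.
Lemma linisom_mul1 : left_id linisom_one linisom_mul.
Proof. by move=> f; apply: linisom_ext. Qed.
Lemma linisom_1mul : right_id linisom_one linisom_mul.
Proof. by move=> f; apply: linisom_ext. Qed.
Lemma linisom_mulV : left_inverse linisom_one linisom_inv linisom_mul.
Proof. by move=> f; apply: linisom_ext => x /=; exact: linisom_funK. Qed.
Lemma linisom_Vmul : right_inverse linisom_one linisom_inv linisom_mul.
Proof. by move=> f; apply: linisom_ext => x /=; exact: linisom_inv_funK. Qed.

HB.instance Definition _ := isGroup.Build linisom
  linisom_mulA linisom_mul1 linisom_1mul linisom_mulV linisom_Vmul.

HB.instance Definition _ := Topological.copy linisom
  (initial_topology (linisom_fun : linisom -> {ptws E -> E})).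

End LinIsom.

Section Dual.
Variables (R : realType) (E : normedModType R).

Definition dual_pred : {pred E -> R^o} :=
  fun f => `[< linear f /\ continuous f >].

Record dual :=
  Dual { dual_fun :> E -> R^o; dual_funP : dual_fun \in dual_pred }.

HB.instance Definition _ := [isSub for dual_fun].
HB.instance Definition _ := [Choice of dual by <:].

Implicit Types f g : dual.

Lemma dual_linear f : linear f.
Proof. by case: f => f /= /asboolP[]. Qed.

Lemma dual_continuous f : continuous f.
Proof. by case: f => f /= /asboolP[]. Qed.

Lemma dual_ext f g : f =1 g -> f = g.
Proof. by move=> fg; apply/val_inj/funext. Qed.

Lemma dual_submod_closed : submod_closed dual_pred.
Proof.
split.
  apply/asboolP; split=> [a x y|x]; last exact: cst_continuous.
  by rewrite scaler0 addr0.
move=> a f g /asboolP[lf cf] /asboolP[lg cg]; apply/asboolP; split.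
  move=> b x y; rewrite !fctE lf lg !scalerDr !scalerA (mulrC a).
  by rewrite addrACA.
move=> x; apply: cvgD; last exact: cg.
by apply: cvgZr; exact: cf.
Qed.

HB.instance Definition _ := GRing.isSubmodClosed.Build R (E -> R^o) dual_pred
  dual_submod_closed.
HB.instance Definition _ := [SubChoice_isSubLmodule of dual by <:].

Definition dual_norm f : R := sup [set `|f x| | x in [set x : E | `|x| <= 1]].

Lemma dualD f g x : (f + g) x = f x + g x. Proof. by []. Qed.
Lemma dualZ a f x : (a *: f) x = a * f x. Proof. by []. Qed.

Lemma dual_appD f x y : f (x + y) = f x + f y.
Proof. by have := dual_linear f 1 x y; rewrite !scale1r. Qed.

Lemma dual_app0 f : f 0 = 0.
Proof. by apply: (addrI (f 0)); rewrite -dual_appD !addr0. Qed.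

Lemma dual_appZ f a x : f (a *: x) = a * f x.
Proof. by have := dual_linear f a x 0; rewrite dual_app0 !addr0. Qed.

Lemma dual_norm_has_sup f :
  has_sup [set `|f x| | x in [set x : E | `|x| <= 1]].
Proof.
split; first by exists `|f 0|, 0 => //=; rewrite normr0.
have /cvgrPdist_lt/(_ 1 ltr01)/nbhs_normP[/= e e0 eP] := @dual_continuous f 0.
exists (2 / e) => _ [x /= x1 <-].
have e2 : 0 < e / 2 by rewrite divr_gt0.
have : `|f ((e / 2) *: x)| < 1.
  rewrite -normrN -[X in `|X|]add0r -(dual_app0 f); apply: eP.
  rewrite /ball_/= sub0r normrN normrZ (gtr0_norm e2).
  rewrite (le_lt_trans (ler_piMr (ltW e2) x1))//.
  by rewrite ltr_pdivrMr// ltr_pMr// ltr1n.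
rewrite dual_appZ normrM (gtr0_norm e2) -ltr_pdivlMl// mulr1 invf_div.
exact: ltW.
Qed.

Lemma dual_norm_ub f x : `|x| <= 1 -> `|f x| <= dual_norm f.
Proof.
by move=> x1; apply: sup_upper_bound; [exact: dual_norm_has_sup|exists x].
Qed.

Lemma dual_norm_le f (M : R) :
  (forall x, `|x| <= 1 -> `|f x| <= M) -> dual_norm f <= M.
Proof.
move=> fM; apply: ge_sup; first by case: (dual_norm_has_sup f).
by move=> _ [x x1 <-]; exact: fM.
Qed.

Lemma dual_norm_ge0 f : 0 <= dual_norm f.
Proof. by rewrite (le_trans _ (@dual_norm_ub f 0 _)) ?normr0. Qed.

Lemma dual_norm_app f x : `|f x| <= dual_norm f * `|x|.
Proof.
have [->|x0] := eqVneq x 0; first by rewrite dual_app0 !normr0 mulr0.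
have nx0 : 0 < `|x| by rewrite normr_gt0.
rewrite -ler_pdivrMr// mulrC.
have -> : `|x|^-1 * `|f x| = `|f (`|x|^-1 *: x)|.
  by rewrite dual_appZ normrM normfV normr_id.
by apply: dual_norm_ub; rewrite normrZ normfV normr_id mulVf ?gt_eqF.
Qed.

Lemma dual_normD f g : dual_norm (f + g) <= dual_norm f + dual_norm g.
Proof.
apply: dual_norm_le => x x1; rewrite dualD (le_trans (ler_normD _ _))//.
by rewrite lerD// dual_norm_ub.
Qed.

Lemma dual_normZ (a : R) f : dual_norm (a *: f) = `|a| * dual_norm f.
Proof.
have normZ_le b g : dual_norm (b *: g) <= `|b| * dual_norm g.
  apply: dual_norm_le => x x1; rewrite dualZ normrM ler_wpM2l//.
  exact: dual_norm_ub.
apply/eqP; rewrite eq_le normZ_le/=.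
have [->|a0] := eqVneq a 0; first by rewrite normr0 mul0r dual_norm_ge0.
rewrite -ler_pdivlMl ?normr_gt0// -normfV.
by apply: le_trans (normZ_le _ _); rewrite scalerA mulVf// scale1r.
Qed.

Lemma dual_norm0_eq0 f : dual_norm f = 0 -> f = 0.
Proof.
move=> f0; apply: dual_ext => x; apply/eqP; rewrite -normr_le0.
by rewrite (le_trans (dual_norm_app f x))// f0 mul0r.
Qed.

HB.instance Definition _ := Lmodule_isNormed.Build R dual
  dual_normD dual_normZ dual_norm0_eq0.

End Dual.

Section Bidual.
Variables (R : realType) (E : normedModType R).

Lemma bidual_eval_subproof (x : E) :
  (fun f : dual E => f x : R^o) \in @dual_pred R (dual E).
Proof.
apply/asboolP; split=> // f.
apply/(@cvgrPdist_lt _ _ _ (nbhs f)) => e e0.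
have x1 : 0 < `|x| + 1 by rewrite ltr_wpDl.
apply/(@nbhs_normP _ (dual E)); exists (e / (`|x| + 1)) => /= [|g fg]; first exact: divr_gt0.
rewrite -[f x - g x]/((f - g) x) (le_lt_trans (dual_norm_app _ _))//.
rewrite (@le_lt_trans _ _ (`|f - g| * (`|x| + 1)))//.
  by rewrite ler_wpM2l ?lerDl// dual_norm_ge0.
by rewrite -ltr_pdivlMr.
Qed.

Definition bidual_eval (x : E) : dual (dual E) := Dual (bidual_eval_subproof x).

End Bidual.

Definition homeomorphism (S T : topologicalType) (f : S -> T) : Prop :=
  continuous f /\
  exists g : T -> S, [/\ cancel f g, cancel g f & continuous g].

Definition reflexive_space (R : realType) (E : normedModType R) : Prop :=
  homeomorphism (@bidual_eval R E).

(* Main.v *)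
Require Import Defs.
From HB Require Import structures.
From mathcomp Require Import all_boot all_order all_algebra.
From mathcomp Require Import all_classical all_reals all_analysis.
From mathcomp Require Import zify lra.

Set Implicit Arguments.
Unset Strict Implicit.
Unset Printing Implicit Defensive.

Import Order.TTheory GRing.Theory Num.Theory.
Import numFieldNormedType.Exports.

Local Open Scope classical_set_scope.
Local Open Scope ring_scope.

(** Let rho be the representation and v a vector. By continuity, v is nearly fixed
by every isometry that moves the points of some finite set s by less than some d.
It has to be shown that every isometry nearly fixes v, with an error of the same
order. Two facts combine.

Reflexivity: along any bounded sequence of vectors there are two convex
combinations, with the second one supported after the first, that are as close
as desired ([reflexive_disjoint_hulls]). Indeed the limit of the sequence along
an ultrafilter defines a functional on the dual space, reflexivity turns it into
a vector, and the Hahn-Banach theorem puts that vector into the closed convex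
hull of every tail of the sequence.

Geometry of U: any finite configuration of distances that extends a given one
can be realised in U. In particular, for any finite set S containing s, there
are copies c q m of S, indexed by a level q and a number m, such that different
copies on the same level are parallel at distance r, and copies on levels q <> q'
are parallel at distance r * |q - q'|. Here r < d, and two copies are said to be
parallel at distance t if the distance from a point of one to a point of the
other always exceeds by t the distance of the corresponding points of S.

Let h m carry S to c 0 m. Since r < d, all the vectors rho (h m) v are close to
v; let u and u' be convex combinations of those with m < N, respectively
m >= N, such that u and u' are very close. Let an isometry put the copies with
m < N on one level and those with m >= N on an adjacent level, and raise these
two families alternately by two levels. At each step one of the families stays
where it is, so that the image of u or that of u' does not change by more than
what S tolerates, while u and u' remain close to each other: the image of u
hardly moves. That tolerance may be chosen after the number of steps, because S
is chosen last. Hence u, and so v, is nearly fixed by an isometry that takes s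
to a parallel copy at an arbitrary distance t ([parallel_move]), with an error
that does not depend on t.

Two moves of this kind take s to a copy all of whose points are at one and the
same distance from all points of s ([equidistant_move]), and two moves of the
latter kind compose to the effect of an arbitrary isometry on s
([rep_moves_little]). *)

(** * Sublinear functionals and the Hahn-Banach theorem *)

Section LinearFunctions.
Variables (R : realType) (V W : lmodType R) (f : V -> W).
Hypothesis f_linear : linear f.

Lemma linear_fun0 : f 0 = 0.
Proof.
have := f_linear (-1) 0 0; rewrite !scaleN1r oppr0 addr0 => ->.
by rewrite addNr.
Qed.

Lemma linear_funB x y : f (x - y) = f x - f y.
Proof. by have := f_linear (-1) y x; rewrite !scaleN1r ![- _ + _]addrC. Qed.

Lemma linear_funN x : f (- x) = - f x.
Proof. by rewrite -sub0r linear_funB linear_fun0 sub0r. Qed.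

Lemma linear_funZ t x : f (t *: x) = t *: f x.
Proof. by have := f_linear t x 0; rewrite linear_fun0 !addr0. Qed.

End LinearFunctions.

Section Sublinear.
Variables (R : realType) (V : lmodType R).
Implicit Types (p : V -> R) (S : set (V * R)) (x y : V) (s t : R).

(** Replacing t by its inverse turns the inequality for scalars t > 0 into an
equality, and forces [p 0 = 0]; the weak form is the one that infima inherit
directly. *)
Definition sublinear p :=
  (forall x y, p (x + y) <= p x + p y) /\
  (forall t x, 0 < t -> p (t *: x) <= t * p x).

Definition is_cone S :=
  [/\ S (0, 0), forall z z', S z -> S z' -> S (z + z')
    & forall t z, 0 < t -> S z -> S (t *: z.1, t * z.2)].

Lemma sublinear0 p : sublinear p -> p 0 = 0.
Proof.
move=> [_ pZ].
have := pZ 2 0 (ltr0n _ 2); rewrite scaler0 => h1.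
have := pZ 2^-1 0; rewrite scaler0 invr_gt0 => /(_ (ltr0n _ 2)) h2.
lra.
Qed.

Lemma sublinear_homogeneous p t x : sublinear p -> 0 < t -> p (t *: x) = t * p x.
Proof.
move=> [_ pZ] t0; apply/eqP; rewrite eq_le pZ //=.
have := pZ t^-1 (t *: x); rewrite invr_gt0 => /(_ t0).
by rewrite scalerA mulVf ?gt_eqF // scale1r ler_pdivlMl.
Qed.

Lemma sublinear_subN p x : sublinear p -> - p (- x) <= p x.
Proof.
move=> sp; have [pD _] := sp.
by have := pD x (- x); rewrite subrr sublinear0 // -lerBlDr sub0r.
Qed.

(** The functional q is the infimum of [p (x + z) - s] over the (z, s) in S. It is
finite because s <= p z bounds these numbers from below by [- p (- x)]. This one
construction gives both the linearity of minimal sublinear functionals and the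
constraint needed to separate a point from a convex set. *)
Lemma sublinear_shift p S : sublinear p -> is_cone S ->
  (forall z, S z -> z.2 <= p z.1) ->
  exists q, [/\ sublinear q, forall x, q x <= p x
              & forall z, S z -> q (- z.1) <= - z.2].
Proof.
move=> sp [S0 SD SZ] Sp; have [pD _] := sp.
pose A x := [set p (x + z.1) - z.2 | z in S].
have Alb x : has_inf (A x).
  split; first by exists (p (x + 0) - 0), (0, 0).
  exists (- p (- x)) => _ [z Sz <-].
  have := pD (x + z.1) (- x); rewrite addrAC subrr add0r.
  by have := Sp z Sz; lra.
have Ale x z : S z -> inf (A x) <= p (x + z.1) - z.2.
  by move=> Sz; apply: ge_inf; [have [] := Alb x|exists z].
have Age x a : (forall z, S z -> a <= p (x + z.1) - z.2) -> a <= inf (A x).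
  move=> h; apply: lb_le_inf; first by have [] := Alb x.
  by move=> _ [z Sz <-]; exact: h.
exists (fun x => inf (A x)); split.
- split=> [x y|t x t0].
    rewrite -lerBlDr; apply: (Age) => z Sz.
    suff : inf (A (x + y)) - (p (x + z.1) - z.2) <= inf (A y) by lra.
    apply: (Age) => z' Sz'; have := Ale (x + y) (z + z') (SD _ _ Sz Sz') => /=.
    by have := pD (x + z.1) (y + z'.1); rewrite addrACA; lra.
  rewrite -ler_pdivrMl //; apply: (Age) => z Sz.
  rewrite ler_pdivrMl // mulrBr -sublinear_homogeneous // scalerDr.
  by apply: (Ale _ (t *: z.1, t * z.2)); apply: SZ.
- by move=> x; have := Ale x _ S0; rewrite /= addr0 subr0.
- by move=> z Sz; have := Ale (- z.1) z Sz; rewrite addNr sublinear0 // sub0r.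
Qed.

(** Zorn's lemma applies because the pointwise infimum of a chain of sublinear
functionals is sublinear: subadditivity only compares two members of the chain,
the smaller of which serves both. Every member is bounded below by
[- p (- x)]. *)
Lemma minimal_sublinear p : sublinear p ->
  exists q, [/\ sublinear q, forall x, q x <= p x
    & forall q', sublinear q' -> (forall x, q' x <= q x) -> q' =1 q].
Proof.
move=> sp.
pose T := {q : V -> R | sublinear q /\ forall x, q x <= p x}.
pose le (f g : T) := `[< forall x, sval g x <= sval f x >].
have p0 : T by exists p.
have [| | |q qmax] := @ZL_preorder T p0 le.
- by move=> t; apply/asboolP.
- move=> f g h /asboolP fg /asboolP gh; apply/asboolP => x.
  exact: le_trans (gh x) (fg x).
- move=> A Atot; have [[q0 Aq0]|A0] := pselect (A !=set0); last first.
    by exists p0 => s As; case: A0; exists s.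
  pose B x := [set sval q x | q in A].
  have Blb x : has_inf (B x).
    split; first by exists (sval q0 x), q0.
    exists (- p (- x)) => _ [[q [sq qp]] Aq <-] /=.
    by apply: le_trans (sublinear_subN x sq); rewrite lerN2.
  have Ble x q : A q -> inf (B x) <= sval q x.
    by move=> Aq; apply: ge_inf; [have [] := Blb x|exists q].
  have Bge x a : (forall q, A q -> a <= sval q x) -> a <= inf (B x).
    move=> h; apply: lb_le_inf; first by have [] := Blb x.
    by move=> _ [q Aq <-]; exact: h.
  have sB : sublinear (fun x => inf (B x)).
    split=> [x y|t x t0]; last first.
      rewrite -ler_pdivrMl //; apply: (Bge) => q Aq.
      rewrite ler_pdivrMl // -sublinear_homogeneous //; first exact: Ble.
      by case: q {Aq} => q [].
    rewrite -lerBlDr; apply: (Bge) => f Af.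
    suff : inf (B (x + y)) - sval f x <= inf (B y) by lra.
    apply: (Bge) => g Ag; rewrite lerBlDr.
    have [fg|gf] := Atot f g Af Ag.
      move/asboolP: fg => fg; apply: le_trans (Ble _ _ Ag) _.
      case: g {Ag} fg => g [[gD gZ] gp] /= fg.
      by apply: le_trans (gD x y) _; rewrite addrC lerD2l.
    move/asboolP: gf => gf; apply: le_trans (Ble _ _ Af) _.
    case: f {Af} gf => f [[fD fZ] fp] /= gf.
    by apply: le_trans (fD x y) _; rewrite addrC lerD2r.
  have Bp x : inf (B x) <= p x.
    by apply: le_trans (Ble _ _ Aq0) _; case: (q0) => q [].
  exists (exist (fun q => sublinear q /\ forall x, q x <= p x)
    (fun x => inf (B x)) (conj sB Bp)) => s As; apply/asboolP => x /=.
  exact: Ble.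
case: q qmax => q [sq qp] qmax; exists q; split=> // q' sq' q'q x.
have q'p y : q' y <= p y by apply: le_trans (q'q y) (qp y).
have /(_ _)/asboolP/= := qmax (exist _ q' (conj sq' q'p)).
move=> h; apply/eqP; rewrite eq_le q'q /=; apply: h.
by apply/asboolP.
Qed.

(** A minimal sublinear functional q is additive: shifting q along the ray of y
can only decrease it, hence leaves it unchanged, and this says that
[q x + q y <= q (x + y)]. *)
Theorem hahn_banach p : sublinear p ->
  exists f : V -> R^o, linear f /\ forall x, f x <= p x.
Proof.
move=> sp; have [q [sq qp qmin]] := minimal_sublinear sp.
have qD x y : q (x + y) = q x + q y.
  apply/eqP; rewrite eq_le (sq.1 x y) /=.
  pose S := [set z : V * R | exists2 t, 0 <= t & z = (t *: y, t * q y)].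
  have [||q' [sq' q'q q'S]] := @sublinear_shift q S sq.
  - split.
    + by exists 0; rewrite ?scale0r ?mul0r.
    + move=> _ _ [s s0 ->] [t t0 ->]; exists (s + t); first exact: addr_ge0.
      by rewrite scalerDl mulrDl.
    + move=> t _ t0 [s s0 ->]; exists (t * s); first by rewrite mulr_ge0// ltW.
      by rewrite scalerA mulrA.
  - move=> _ [t t0 ->] /=; move: t0; rewrite le_eqVlt => /orP[/eqP <-|t0].
      by rewrite scale0r mul0r sublinear0.
    by rewrite sublinear_homogeneous.
  have q'E := qmin q' sq' q'q.
  have /= := q'S (y, q y); rewrite q'E => /(_ _) h.
  have {h} h : q (- y) <= - q y.
    by apply: h; exists 1; rewrite ?scale1r ?mul1r.
  have := sq.1 (x + y) (- y); rewrite addrK; lra.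
have qN x : q (- x) = - q x.
  by apply/eqP; rewrite -addr_eq0 -qD addNr sublinear0.
have qZ t x : 0 <= t -> q (t *: x) = t * q x.
  rewrite le_eqVlt => /orP[/eqP <-|t0]; last exact: sublinear_homogeneous.
  by rewrite scale0r mul0r sublinear0.
exists q; split=> // t x y; rewrite qD; congr (_ + _).
have [t0|t0] := leP 0 t; first exact: qZ.
by rewrite -[t in LHS]opprK scaleNr qN qZ ?oppr_ge0 ?ltW // mulNr opprK.
Qed.

(** A linear functional below the shift of p by S is at most p, and its value at
[- z] is at most [- s] for (z, s) in S. *)
Theorem mazur_orlicz p S : sublinear p -> is_cone S ->
  (forall z, S z -> z.2 <= p z.1) ->
  exists f : V -> R^o, [/\ linear f, forall x, f x <= p x
    & forall z, S z -> z.2 <= f z.1].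
Proof.
move=> sp cS Sp; have [q [sq qp qS]] := sublinear_shift sp cS Sp.
have [f [lf fq]] := hahn_banach sq; exists f; split=> //.
  by move=> x; apply: le_trans (fq x) (qp x).
by move=> z Sz; have := le_trans (fq (- z.1)) (qS z Sz);
  rewrite (linear_funN lf) lerN2.
Qed.

End Sublinear.

(** * Convex hulls *)

Section ConvexHull.
Variables (R : realType) (V : lmodType R).

Lemma convex_setP (K : set (convex_lmodType V)) : convex_set K <->
  forall (x y : V) (t : R), 0 <= t -> t <= 1 -> K x -> K y ->
  K (t *: x + (1 - t) *: y).
Proof.
split=> [cK x y t t0 t1 Kx Ky|cK x y t].
  have := cK x y (Itv01 t0 t1); rewrite !inE => /(_ Kx Ky).
  exact.
by rewrite !inE => Kx Ky; apply: cK.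
Qed.

(** The hull is an intersection of convex sets, so that a property of all its
elements follows as soon as the property is convex and holds on S; explicit
coefficients never occur. *)
Definition convex_hull (S : set V) : set V :=
  [set x | forall K : set (convex_lmodType V), convex_set K -> S `<=` K -> K x].

Lemma sub_convex_hull S : S `<=` convex_hull S.
Proof. by move=> x Sx K _; apply. Qed.

Lemma convex_hull_convex S :
  convex_set (convex_hull S : set (convex_lmodType V)).
Proof.
apply/convex_setP => x y t t0 t1 hx hy K cK SK.
by move/convex_setP: (cK); apply => //; [exact: hx|exact: hy].
Qed.

Lemma convex_hullS S S' : S `<=` S' -> convex_hull S `<=` convex_hull S'.
Proof. by move=> SS' x hx K cK S'K; apply: hx => // y /SS'/S'K. Qed.

(** The union of the hulls of the finite pieces is convex because these pieces
increase with M. *)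
Lemma convex_hull_finite (v : nat -> V) (N : nat) x :
  convex_hull [set v n | n in [set n | (N <= n)%N]] x ->
  exists M, convex_hull [set v n | n in [set n | (N <= n < M)%N]] x.
Proof.
move=> hx; apply: (hx [set y | exists M,
    convex_hull [set v n | n in [set n | (N <= n < M)%N]] y]).
  apply/convex_setP => {hx}x y t t0 t1 [M Mx] [M' My]; exists (maxn M M').
  move/convex_setP: (@convex_hull_convex
    [set v n | n in [set n | (N <= n < maxn M M')%N]]); apply => //.
    apply: convex_hullS Mx => _ [n /= /andP[Nn nM] <-].
    by exists n => //=; rewrite Nn (leq_trans nM) // leq_maxl.
  apply: convex_hullS My => _ [n /= /andP[Nn nM] <-].
  by exists n => //=; rewrite Nn (leq_trans nM) // leq_maxr.
move=> _ [n /= Nn <-]; exists n.+1; apply: sub_convex_hull.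
by exists n => //=; rewrite Nn ltnSn.
Qed.

End ConvexHull.

(** * Convex combinations in reflexive spaces *)

Section Reflexive.
Variables (R : realType) (E : normedModType R).

Lemma convex_set_norm_le (F : normedModType R) (f : E -> F) (e : R) (a : F) :
  linear f -> convex_set ([set x | `|f x - a| <= e] : set (convex_lmodType E)).
Proof.
move=> lf; apply/convex_setP => x y t t0 t1 /= xe ye.
have -> : f (t *: x + (1 - t) *: y) - a = t *: (f x - a) + (1 - t) *: (f y - a).
  by rewrite lf (linear_funZ lf) !scalerBr addrACA -opprD -scalerDl (addrC t)
    subrK scale1r.
apply: le_trans (ler_normD _ _) _.
rewrite !normrZ (ger0_norm t0) ger0_norm ?subr_ge0 //.
have := ler_wpM2l t0 xe; have := ler_wpM2l (_ : 0 <= 1 - t) ye.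
by rewrite subr_ge0 => /(_ t1); lra.
Qed.

Lemma linear_bounded_continuous (F : normedModType R) (f : F -> R^o) (M : R) :
  linear f -> (forall x, `|f x| <= M * `|x|) -> continuous f.
Proof.
move=> lf fM x; apply/(@cvgrPdist_lt _ _ _ (nbhs x)) => e e0.
have M1 : 0 < `|M| + 1 by rewrite ltr_wpDl.
apply/(@nbhs_normP _ F); exists (e / (`|M| + 1)) => /= [|y xy].
  exact: divr_gt0.
rewrite -(linear_funB lf); apply: le_lt_trans (fM _) _.
have {}xy : `|x - y| * (`|M| + 1) < e by rewrite -ltr_pdivlMr.
apply: le_lt_trans xy.
rewrite mulrC ler_wpM2l //.
by apply: le_trans (ler_norm M) _; rewrite lerDl.
Qed.

(** The constraints [t * e <= f (t (w - c))] for t >= 0 and c in C form a cone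
because C is convex, and the norm satisfies them because w is at distance at
least e from C. *)
Lemma separation (C : set E) (w : E) (e : R) :
  convex_set (C : set (convex_lmodType E)) -> 0 < e ->
  (forall c, C c -> e <= `|w - c|) ->
  exists f : dual E, forall c, C c -> e <= f (w - c).
Proof.
move=> /convex_setP cC e0 Ce.
pose S := [set z : E * R | z = (0, 0) \/
  exists t c, [/\ 0 < t, C c & z = (t *: (w - c), t * e)]].
have sn : sublinear (fun x : E => `|x|).
  by split=> [x y|t x t0]; [exact: ler_normD|rewrite normrZ gtr0_norm].
have [||f [lf fn fS]] := @mazur_orlicz R E _ S sn.
- split; first by left.
    move=> x y [->|[t [c [t0 Cc ->]]]]; first by rewrite [_ + _]add0r.
    move=> [->|[t' [c' [t'0 Cc' ->]]]]; right.
      by exists t, c; rewrite [_ + _]addr0.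
    have tt' : 0 < t + t' by exact: addr_gt0.
    exists (t + t'), ((t / (t + t')) *: c + (1 - t / (t + t')) *: c').
    split=> //.
      apply: cC => //; first by rewrite divr_ge0 // ltW.
      by rewrite ler_pdivrMr // mul1r lerDl ltW.
    congr (_, _); rewrite /= -?mulrDl //.
    rewrite [RHS]scalerBr (scalerDr (t + t')) !scalerA mulrBr mulr1.
    rewrite (mulrC _ (t / _)) divfK ?gt_eqF //.
    rewrite (addrC t t') addrK (addrC t' t) !scalerBr addrACA.
    by rewrite -scalerDl -opprD addrC.
  move=> t x t0 [->|[t' [c [t'0 Cc ->]]]]; [left|right] => /=.
    by rewrite scaler0 mulr0.
  by exists (t * t'), c; rewrite mulr_gt0 // scalerA mulrA.
- move=> z [->|[t [c [t0 Cc ->]]]] /=; first by rewrite normr0.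
  by rewrite normrZ gtr0_norm // ler_pM2l // Ce.
have fle x : `|f x| <= 1 * `|x|.
  by rewrite mul1r ler_norml fn andbT lerNl -(linear_funN lf) -[leRHS]normrN fn.
have fd : f \in @dual_pred R E.
  by apply/asboolP; split=> //; exact: linear_bounded_continuous fle.
exists (Dual fd) => c Cc; apply: (fS (w - c, e)); right; exists 1, c.
by rewrite scale1r mul1r.
Qed.

(** An ultrafilter cannot leave a neighbourhood of one of its cluster points. *)
Lemma ultra_cvg_compact (T : Type) (X : topologicalType) (G : set_system T)
    (f : T -> X) (K : set X) : UltraFilter G -> compact K ->
  (forall t, K (f t)) -> exists2 p, K p & f @ G --> p.
Proof.
move=> GU cK fK.
have [|p [Kp cp]] := cK (f @ G) _; first by apply: (@filterE _ G) => t; exact: fK.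
exists p => // A nA.
have [//|GcA] := in_ultra_setVsetC (f @^-1` A) GU.
by have [x [/= nAx Ax]] := cp (~` A) A GcA nA.
Qed.

(** The vector w represents the functional [f |-> lim f (v n)] on the dual space,
where the limit is taken along an ultrafilter that contains all tails. If w had
distance at least e from the hull of a tail, some f would satisfy
[f (v n) <= f w - e] on that tail, hence also in the limit. *)
Theorem reflexive_hull_limit (v : nat -> E) (M : R) :
  reflexive_space E -> (forall n, `|v n| <= M) ->
  exists w, forall N e, 0 < e -> exists2 c,
    convex_hull [set v n | n in [set n | (N <= n)%N]] c & `|w - c| < e.
Proof.
move=> [_ [inv [_ evK _]]] vM.
have [G [GU ooG]] := @ultraFilterLemma nat \oo _.
have M0 : 0 <= M by exact: le_trans (vM 0).
have lim_ex (f : dual E) : exists l : R^o, `|l| <= dual_norm f * M /\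
    (f (v n) : R^o) @[n --> G] --> l.
  have [|l] := @ultra_cvg_compact nat R^o G (fun n => f (v n))
      `[- (dual_norm f * M), dual_norm f * M] GU (@segment_compact _ _ _).
    move=> n; rewrite /= in_itv /= -ler_norml.
    by apply: le_trans (dual_norm_app f _) _; rewrite ler_wpM2l ?dual_norm_ge0.
  by rewrite /= in_itv /= -ler_norml; exists l.
pose Phi (f : dual E) : R^o := sval (cid (lim_ex f)).
have PhiP (f : dual E) : `|Phi f| <= dual_norm f * M /\
    (f (v n) : R^o) @[n --> G] --> Phi f by rewrite /Phi; case: cid.
have PhiE (f : dual E) (l : R^o) : (f (v n) : R^o) @[n --> G] --> l ->
    Phi f = l.
  by move=> fl; apply: (cvg_unique _ (PhiP f).2 fl); exact: norm_hausdorff.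
have Phi_linear : linear Phi.
  move=> a f g; apply: PhiE => /=.
  apply: cvgD; last exact: (PhiP g).2.
  by apply: cvgZr; exact: (PhiP f).2.
have Phi_dual : Phi \in @dual_pred R (dual E).
  apply/asboolP; split=> //.
  apply: (linear_bounded_continuous Phi_linear (M := M)) => f.
  by rewrite mulrC; exact: (PhiP f).1.
pose w := inv (Dual Phi_dual).
have wE (f : dual E) : f w = Phi f.
  by rewrite -[f w]/(bidual_eval w f) /w evK.
exists w => N e e0; apply: contrapT => noc.
have [|f fe] := @separation _ w e (@convex_hull_convex _ _
    [set v n | n in [set n | (N <= n)%N]]) e0.
  by move=> c hc; rewrite leNgt; apply/negP => wc; apply: noc; exists c.
have : \forall n \near G, f (v n) <= f w - e.
  apply: ooG; exists N => // n /= Nn.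
  have := fe (v n) (sub_convex_hull (ex_intro2 _ _ n Nn erefl)).
  have := dual_appD f (w - v n) (v n); rewrite subrK => ->; lra.
move=> /(closed_cvg _ (@closed_le R (f w - e)))/(_ _ (PhiP f).2).
by rewrite /= wE; lra.
Qed.

(** Both combinations approximate the same limit vector. *)
Corollary reflexive_disjoint_hulls (v : nat -> E) (M : R) (e : R) :
  reflexive_space E -> (forall n, `|v n| <= M) -> 0 < e ->
  exists N K (x y : E), [/\ (0 < N)%N,
    convex_hull [set v n | n in [set n | (n < N)%N]] x,
    convex_hull [set v n | n in [set n | (N <= n < K)%N]] y & `|x - y| < e].
Proof.
move=> rE vM e0; have [w wP] := reflexive_hull_limit rE vM.
have e2 : 0 < e / 2 by rewrite divr_gt0.
have [x hx wx] := wP 0%N _ e2; have [N hN] := convex_hull_finite hx.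
have [y hy wy] := wP N.+1 _ e2; have [K hK] := convex_hull_finite hy.
exists N.+1, K, x, y; split => //.
  by apply: convex_hullS hN => _ [n /= nN <-]; exists n => //=; exact: leqW.
have -> : x - y = (w - y) - (w - x) by rewrite opprB [RHS]addrC addrA subrK.
by apply: le_lt_trans (ler_normB _ _) _; rewrite [e]splitr ltrD.
Qed.

End Reflexive.

(** * Realising distances in the Urysohn space *)

Definition is_pseudometric (R : realType) (T : Type) (D : T -> T -> R) :=
  [/\ forall x, D x x = 0, forall x y, D x y = D y x
    & forall y x z, D x z <= D x y + D y z].

Section MetricQuotient.
Variables (R : realType) (T : countType) (D : T -> T -> R).
Hypothesis D_pm : is_pseudometric D.

Let D0 x : D x x = 0. Proof. by case: D_pm. Qed.
Let Dsym x y : D x y = D y x. Proof. by case: D_pm. Qed.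
Let Dtri y x z : D x z <= D x y + D y z. Proof. by case: D_pm. Qed.

Let D_eq0_trans x y : D x y = 0 -> forall z, D x z = D y z.
Proof.
move=> xy z; have := Dtri y x z; have := Dtri x y z.
by rewrite (Dsym y x) xy; lra.
Qed.

(** Since [choose] only depends on the extension of its predicate, points at
distance 0 from each other get the same representative. *)
Definition metric_repr (x : T) : T := choose (fun y => D x y == 0) x.

Lemma metric_reprP x : D x (metric_repr x) = 0.
Proof. by apply/eqP/(@chooseP _ (fun y => D x y == 0)); rewrite D0. Qed.

Lemma metric_repr_eq x y : D x y = 0 -> metric_repr x = metric_repr y.
Proof.
move=> xy; rewrite /metric_repr.
have -> : (fun z => D x z == 0) = (fun z => D y z == 0).
  by apply/funext => z; rewrite (D_eq0_trans xy).
by apply: choose_id; rewrite ?D0 // Dsym xy.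
Qed.

Lemma metric_repr_id x : metric_repr (metric_repr x) == metric_repr x.
Proof. by apply/eqP/esym/metric_repr_eq; exact: metric_reprP. Qed.

(** The metric space associated with D, as the set of representatives. It takes
the proof as an argument so that the metric structure can be found from the type
alone. *)
Definition metric_quotient (_ : is_pseudometric D) :=
  {x : T | metric_repr x == x}.

HB.instance Definition _ := Countable.on (metric_quotient D_pm).

Let dist (x y : metric_quotient D_pm) : R := D (val x) (val y).

Let dist_eq0 x y : dist x y = 0 -> x = y.
Proof.
move=> /metric_repr_eq; rewrite (eqP (valP x)) (eqP (valP y)); exact: val_inj.
Qed.

Let distxx x : dist x x = 0. Proof. exact: D0. Qed.
Let distC x y : dist x y = dist y x. Proof. exact: Dsym. Qed.
Let dist_triangle y x z : dist x z <= dist x y + dist y z.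
Proof. exact: Dtri. Qed.

HB.instance Definition _ := isMetric.Build R (metric_quotient D_pm)
  distxx dist_eq0 distC dist_triangle.

Definition metric_pi (x : T) : metric_quotient D_pm :=
  exist _ (metric_repr x) (metric_repr_id x).

Lemma mdist_metric_pi x y : mdist (metric_pi x) (metric_pi y) = D x y.
Proof.
rewrite -[LHS]/(D (metric_repr x) (metric_repr y)).
rewrite -(D_eq0_trans (metric_reprP x)) Dsym -(D_eq0_trans (metric_reprP y)).
exact: Dsym.
Qed.

Lemma separable_metric_quotient : separable (metric_quotient D_pm).
Proof.
by exists setT; [exact: countableP|move=> O O0 _; rewrite setIT].
Qed.

End MetricQuotient.

Section Urysohn.
Variables (R : realType) (U : metricType R).
Hypothesis U_urysohn : urysohn U.

Lemma urysohn_embedding (T : countType) (D : T -> T -> R) :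
  is_pseudometric D -> exists b : T -> U, forall x y, mdist (b x) (b y) = D x y.
Proof.
move=> Dp; have [_ _ univ _] := U_urysohn.
have [f fi] := univ _ (separable_metric_quotient Dp).
by exists (fun x => f (metric_pi Dp x)) => x y; rewrite fi mdist_metric_pi.
Qed.

(** Ultrahomogeneity for indexed families, which may have repetitions. *)
Lemma urysohn_homogeneous (T : eqType) (s : seq T) (a b : T -> U) :
  {in s &, forall x y, mdist (b x) (b y) = mdist (a x) (a y)} ->
  exists g : isom U, {in s, forall x, g (a x) = b x}.
Proof.
move=> ab; have [_ _ _ hom] := U_urysohn.
have [->|[t0 t0s]] : s = [::] \/ exists t0, t0 \in s.
- by case: s {ab} => [|t s]; [left|right; exists t; rewrite mem_head].
- by exists 1%g.
have ex_pre u : exists t, (exists2 t', t' \in s & u = a t') ->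
    t \in s /\ u = a t.
  have [[t ts ->]|nt] := pselect (exists2 t', t' \in s & u = a t').
    by exists t.
  by exists t0.
pose p u := sval (cid (ex_pre u)).
have pP t : t \in s -> p (a t) \in s /\ a t = a (p (a t)).
  by move=> ts; rewrite /p; case: cid => t' /= h; apply: h; exists t.
have bp t : t \in s -> b (p (a t)) = b t.
  move=> ts; apply: mdist_positivity; have [ps pe] := pP t ts.
  by rewrite ab // -pe mdistxx.
have fin (c : T -> U) : finite_set [set c t | t in [set` s]].
  exact/finite_image/finite_seq.
have [||g gP] := hom [set a t | t in [set` s]] [set b t | t in [set` s]]
    (fun u => b (p u)) (fin a) (fin b).
- split=> [_ [t /= ts <-]|u v /set_mem[t /= ts <-] /set_mem[t' /= t's <-]|].
  + by exists t => //; rewrite bp.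
  + rewrite !bp // => bb; apply: mdist_positivity.
    by rewrite -ab // bb mdistxx.
  + by move=> _ [t /= ts <-]; exists (a t); [exists t|rewrite /= bp].
- by move=> _ _ [t /= ts <-] [t' /= t's <-]; rewrite !bp // ab.
by exists g => t ts; rewrite gP ?bp //; exists t.
Qed.

(** Universality places the whole of T somewhere in U, and homogeneity brings the
finite part s back to where it is prescribed. *)
Lemma urysohn_extension (T : countType) (D : T -> T -> R) (s : seq T)
    (a : T -> U) : is_pseudometric D ->
  {in s &, forall x y, mdist (a x) (a y) = D x y} ->
  exists b : T -> U, (forall x y, mdist (b x) (b y) = D x y) /\
    {in s, b =1 a}.
Proof.
move=> Dp aD; have [b bD] := urysohn_embedding Dp.
have [|g gP] := @urysohn_homogeneous T s b a.
  by move=> x y xs ys; rewrite aD // bD.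
exists (fun x => g (b x)); split => // x y.
by rewrite isom_isometric bD.
Qed.

(** The four conditions are the triangle inequalities in the disjoint union of I
and J that involve both sides; they make that union a pseudometric space which
extends the configuration of z. *)
Lemma urysohn_move (I J : finType) (x : I -> U) (z : J -> U)
    (e : I -> J -> R) :
  (forall i j k, e i j <= e i k + mdist (z k) (z j)) ->
  (forall i j k, mdist (z j) (z k) <= e i j + e i k) ->
  (forall i j k, e i j <= mdist (x i) (x k) + e k j) ->
  (forall i j k, mdist (x i) (x k) <= e i j + e k j) ->
  exists g : isom U, forall i j, mdist (g (x i)) (z j) = e i j.
Proof.
move=> e1 e2 e3 e4.
pose D (p q : I + J) := match p, q with
  | inl i, inl k => mdist (x i) (x k)
  | inl i, inr j => e i j
  | inr j, inl i => e i j
  | inr j, inr k => mdist (z j) (z k) end.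
have Dp : is_pseudometric D.
  split.
  - by case=> i /=; rewrite mdistxx.
  - by case=> [i|j] [k|l] //=; rewrite metric_sym.
  - case=> [i|j] [k|l] [m|n] /=.
    + exact: metric_triangle.
    + exact: e3.
    + by rewrite addrC (metric_sym (x i)) e3.
    + exact: e2.
    + exact: e4.
    + exact: e1.
    + by rewrite addrC metric_sym e1.
    + exact: metric_triangle.
have [|b [bD bz]] := @urysohn_extension _ D [seq inr j | j <- enum J]
  (fun p => match p with inl i => x i | inr j => z j end) Dp.
  by move=> _ _ /mapP[j _ ->] /mapP[k _ ->].
have [|g gP] := @urysohn_homogeneous I (enum I) x (fun i => b (inl i)).
  by move=> i k _ _; rewrite bD.
exists g => i j; rewrite gP ?mem_enum // -[e i j](bD (inl i) (inr j)).
by rewrite (bz (inr j)) //; apply: map_f; rewrite mem_enum.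
Qed.

(** Any two copies of x are parallel, that is, the distance from a point of one to
a point of the other exceeds the distance in x by a constant. Here m separates
copies only up to r, while the levels q and q' may be arbitrarily far apart. *)
Lemma parallel_copies (I : finType) (x : I -> U) (r : R) : 0 <= r ->
  exists c : nat -> nat -> I -> U, (forall i, c 0%N 0%N i = x i) /\
  forall q m i q' n j, mdist (c q m i) (c q' n j) =
    mdist (x i) (x j) + r * (maxn (m != n) ((q - q') + (q' - q)))%:R.
Proof.
move=> r0.
pose rk (p p' : nat * nat * I) :=
  maxn (p.1.2 != p'.1.2) ((p.1.1 - p'.1.1) + (p'.1.1 - p.1.1)).
pose D p p' : R := mdist (x p.2) (x p'.2) + r * (rk p p')%:R.
have Dp : is_pseudometric D.
  split.
  - by move=> [[q m] i]; rewrite /D /rk /= mdistxx eqxx subnn mulr0 addr0.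
  - move=> [[q m] i] [[q' n] j]; rewrite /D /rk /= metric_sym eq_sym.
    by rewrite (addnC (q - q')%N).
  - move=> [[q' n] j] [[q m] i] [[q'' l] k]; rewrite /D /=.
    have tri : (rk (q, m, i) (q'', l, k) <=
        rk (q, m, i) (q', n, j) + rk (q', n, j) (q'', l, k))%N.
      rewrite /rk /=.
      by case: (eqVneq m n) => ?; case: (eqVneq n l) => ?;
        case: (eqVneq m l) => ? /=; lia.
    have := metric_triangle (x i) (x j) (x k).
    have : r * (rk (q, m, i) (q'', l, k))%:R <=
        r * (rk (q, m, i) (q', n, j) + rk (q', n, j) (q'', l, k))%:R.
      by rewrite ler_wpM2l // ler_nat.
    by rewrite natrD; lra.
have [|b [bD bx]] := @urysohn_extension _ D
  [seq (0%N, 0%N, i) | i <- enum I] (fun p => x p.2) Dp.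
  move=> _ _ /mapP[i _ ->] /mapP[j _ ->]; rewrite /D /rk /=.
  by rewrite mulr0 addr0.
exists (fun q m i => b (q, m, i)); split=> [i|q m i q' n j].
  by rewrite bx // map_f // mem_enum.
by rewrite bD.
Qed.

(** When the new levels differ by at most one, the distance between two different
copies is still r, so that raising them is a partial isometry. *)
Lemma level_shift (I : finType) (x : I -> U) (r : R)
    (c : nat -> nat -> I -> U) (lev : nat -> nat) (M : nat) :
  (forall q m i q' n j, mdist (c q m i) (c q' n j) =
    mdist (x i) (x j) + r * (maxn (m != n) ((q - q') + (q' - q)))%:R) ->
  (forall m n, m != n -> (lev m <= lev n + 1)%N) ->
  exists g : isom U, forall m i, (m < M)%N -> g (c 0%N m i) = c (lev m) m i.
Proof.
move=> cD levP.
have [|g gP] := @urysohn_homogeneous _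
  [seq (m, i) | m <- iota 0 M, i <- enum I]
  (fun p => c 0%N p.1 p.2) (fun p => c (lev p.1) p.1 p.2).
  move=> [m i] [n j] _ _ /=; rewrite !cD; congr (_ + _ * _%:R).
  have := levP m n; have := levP n m.
  by case: (eqVneq m n) => [->|_] /=; rewrite ?eqxx; lia.
exists g => m i mM; apply: (gP (m, i)).
by apply: allpairs_f; rewrite ?mem_iota ?mem_enum.
Qed.

End Urysohn.

(** * Representations of the isometry group *)

Lemma nbhs_isom1 (R : realType) (U : metricType R) (A : set (isom U)) :
  nbhs (1%g : isom U) A -> exists s : seq U, exists2 d : R, 0 < d &
  forall g : isom U, {in s, forall a, mdist a (g a) < d} -> A g.
Proof.
pose near1 (p : seq U * R) : set (isom U) :=
  [set g | {in p.1, forall a, mdist a (g a) < p.2}].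
pose F := filter_from [set p : seq U * R | 0 < p.2] near1.
have FF : Filter F.
  apply: filter_from_filter; first by exists ([::], 1) => /=.
  move=> [s d] [s' d'] /= d0 d'0; exists (s ++ s', Num.min d d').
    by rewrite /= lt_min d0.
  move=> g /= gP; split=> a /= sa.
    by have /= := gP a; rewrite mem_cat sa lt_min => /(_ isT)/andP[].
  by have /= := gP a; rewrite mem_cat sa orbT lt_min => /(_ isT)/andP[].
have Fid : {ptws, (@isom_fun R U) @ F --> (id : U -> U)}.
  apply/pointwise_cvgP => a; apply/cvg_ballP => e e0.
  exists ([:: a], e) => //= g /(_ a (mem_head _ _)) /=.
  by rewrite ballEmdist.
move=> [_ [[B Bop <-] B1 BA]].
have FB : F (@isom_fun R U @^-1` B).
  by apply: Fid; apply: open_nbhs_nbhs; split.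
have [[s d] /= d0 sdB] := FB.
by exists s, d => // g gs; apply: BA; apply: sdB.
Qed.

Section Representation.
Variables (R : realType) (U : metricType R) (E : completeNormedModType R).
Variable rho : {multiplicative isom U -> linisom E}.

Implicit Types (g h : isom U) (v w : E) (s : seq U) (e d : R).

Lemma rep1 v : rho 1%g v = v.
Proof.
have -> // : rho 1%g = 1%g.
by apply: (@mulgI _ (rho 1%g)); rewrite -gmulfM !mulg1.
Qed.

Lemma repM g h v : rho (g * h)%g v = rho g (rho h v).
Proof. by rewrite gmulfM. Qed.

Lemma linisom_dist (f : linisom E) v w : `|f v - f w| = `|v - w|.
Proof.
by rewrite -(linear_funB (@linisom_linear _ _ f)) linisom_norm.
Qed.

Lemma rep_dist g h v : `|rho g v - rho h v| = `|rho (h^-1 * g)%g v - v|.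
Proof.
by rewrite -[RHS](linisom_dist (rho h)) -repM mulgA mulgV mul1g.
Qed.

Definition moves_little_near s d v e :=
  forall g, {in s, forall a, mdist a (g a) < d} -> `|rho g v - v| < e.

Lemma rep_continuous_at1 v e : continuous (rho : isom U -> linisom E) -> 0 < e ->
  exists s, exists2 d, 0 < d & moves_little_near s d v e.
Proof.
move=> rhoc e0.
have fc : continuous (@linisom_fun R E : linisom E -> {ptws E -> E}).
  exact: initial_continuous.
have : {ptws, (fun g => linisom_fun (rho g)) @ nbhs (1%g : isom U) -->
    linisom_fun (rho 1%g)}.
  exact: (continuous_comp (@rhoc 1%g) (@fc _)).
move=> /pointwise_cvgP/(_ v)/cvgrPdist_lt/(_ e e0).
move=> /nbhs_isom1[s [d d0 sd]].
exists s, d => // g /sd; rewrite rep1.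
by rewrite distrC.
Qed.

Lemma rep_eq_on s d v e g h : 0 < d -> moves_little_near s d v e ->
  {in s, g =1 h} -> `|rho g v - rho h v| < e.
Proof.
move=> d0 sd gh; rewrite rep_dist; apply: sd => a sa.
have -> : (h^-1 * g)%g a = a by rewrite [LHS]/= gh // isom_funK.
by rewrite mdistxx.
Qed.

Hypothesis U_urysohn : urysohn U.
Hypothesis E_reflexive : reflexive_space E.
Hypothesis rho_continuous : continuous (rho : isom U -> linisom E).

(** Up to e, the vector [rho (g * h m) v] is determined by the values of [g * h m]
on s, and the bound on the difference passes to convex combinations. *)
Lemma rep_hull_agree (I : finType) (x : I -> U) (h : nat -> isom U)
    (P : set nat) s d v e (g g' : isom U) u :
  0 < d -> moves_little_near s d v e ->
  (forall a, a \in s -> exists i, a = x i) ->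
  (forall m i, P m -> g (h m (x i)) = g' (h m (x i))) ->
  convex_hull [set rho (h m) v | m in P] u -> `|rho g u - rho g' u| <= e.
Proof.
move=> d0 sd sx gg' hu.
have lin : linear (fun w => rho g w - rho g' w : E).
  by move=> a y z; rewrite !linisom_linear scalerBr opprD addrACA.
have := hu _ (@convex_set_norm_le _ _ _ _ e 0 lin); rewrite /= subr0; apply.
move=> _ [m Pm <-] /=; rewrite subr0 -!repM ltW //.
apply: rep_eq_on sd _ => // a /sx[i ->] /=; exact: gg'.
Qed.

(** The step length r is t divided by an even number 2 k of steps, and less than d.
The precision e1 is e divided by that number; it determines the set s' which has
to be moved along with s. The errors of the steps then add up to a multiple of e
that does not depend on k. *)
Lemma parallel_move s d v e (t : R) (f : isom U) : 0 < e -> 0 < d -> 0 < t ->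
  moves_little_near s d v e ->
  {in s &, forall a b, mdist (f a) b = mdist a b + t} ->
  `|rho f v - v| <= 8 * e.
Proof.
move=> e0 d0 t0 sd ft.
pose k := (Num.trunc (t / d)).+1.
have k0 : (0 : R) < k%:R by rewrite ltr0n.
pose r := t / (k%:R *+ 2).
have r0 : 0 < r by rewrite divr_gt0 // pmulrn_lgt0.
have rd : r < d.
  have : t / d < k%:R by rewrite /k truncnS_gt.
  rewrite ltr_pdivrMr // /r ltr_pdivrMr ?pmulrn_lgt0 // => h.
  by rewrite mulrnAr mulr2n; have := mulr_gt0 k0 d0; lra.
pose e1 := e / (k%:R *+ 2).
have e10 : 0 < e1 by rewrite divr_gt0 // pmulrn_lgt0.
have e1k : e1 * k%:R *+ 2 = e.
  by rewrite -mulrnAr divfK // gt_eqF // pmulrn_lgt0.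
have rk : r * k%:R *+ 2 = t.
  by rewrite -mulrnAr divfK // gt_eqF // pmulrn_lgt0.
have [s' [d' d'0 sd']] := rep_continuous_at1 v rho_continuous e10.
pose I : finType := seq_sub (s ++ s'); pose x (i : I) : U := ssval i.
have sx a : a \in s -> exists i, a = x i.
  move=> sa; have sa' : a \in s ++ s' by rewrite mem_cat sa.
  by exists (SeqSub sa').
have s'x a : a \in s' -> exists i, a = x i.
  move=> sa; have sa' : a \in s ++ s' by rewrite mem_cat sa orbT.
  by exists (SeqSub sa').
have [c [c0 cD]] := @parallel_copies _ _ U_urysohn I x r (ltW r0).
have /choice[h hP] : forall m, exists h : isom U, forall i, h (x i) = c 0%N m i.
  move=> m; have [|h hP] := @urysohn_homogeneous _ _ U_urysohn I (enum I) x
    (c 0%N m).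
    by move=> i j _ _; rewrite cD eqxx maxnn mulr0 addr0.
  by exists h => i; rewrite hP // mem_enum.
pose vm m := rho (h m) v.
have vm_near m : `|vm m - v| <= e.
  apply/ltW/sd => a /sx[i ->]; rewrite hP -c0 cD mdistxx add0r.
  by apply: le_lt_trans rd; rewrite ler_piMr ?(ltW r0)//; case: (_ != _).
have [|N [K [u [u' [N0 hu hu' uu']]]]] :=
  @reflexive_disjoint_hulls R E vm `|v| e1 E_reflexive _ e10.
  by move=> m; rewrite linisom_norm.
have uv : `|u - v| <= e.
  have lin : linear (fun w : E => w) by [].
  have := hu _ (@convex_set_norm_le _ _ _ _ e v lin); apply.
  by move=> _ [m _ <-]; exact: vm_near.
(* The copies with m < N are on even levels, the others on odd ones. From an even
   q to q + 1 the former rise by two levels, from an odd q to q + 1 the latter;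
   odd q + q./2 is q / 2 rounded up. *)
pose lev q m := if (m < N)%N then (odd q + q./2).*2 else (q./2).*2.+1.
have /choice[gam gamP] : forall q, exists g : isom U, forall m i,
    (m < N + K)%N -> g (c 0%N m i) = c (lev q m) m i.
  move=> q; apply: (level_shift U_urysohn _ cD) => m n _; rewrite /lev.
  by case: (odd q); case: (m < N)%N; case: (n < N)%N => /=; lia.
have step q : `|rho (gam q) u - rho (gam q.+1) u| <= 3 * e1.
  have [oq|nq] := boolP (odd q).
    (* Here the copies on which u depends stay in place. *)
    apply: le_trans (_ : e1 <= _); last by lra.
    apply: (rep_hull_agree d'0 sd' s'x _ hu) => m i /= mN.
    have mNK : (m < N + K)%N by rewrite ltn_addr.
    rewrite hP !gamP // /lev mN; congr (c _ m i).
    by rewrite /= oq /= uphalf_half oq.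
  (* Here those of u' stay in place, and u follows u'. *)
  have h1 : `|rho (gam q) u' - rho (gam q.+1) u'| <= e1.
    apply: (rep_hull_agree d'0 sd' s'x _ hu') => m i /= /andP[Nm mK].
    have mNK : (m < N + K)%N by rewrite ltn_addl.
    rewrite hP !gamP // /lev ltnNge Nm /=; congr (c _ m i).
    by rewrite uphalf_half (negbTE nq).
  have h2 := linisom_dist (rho (gam q)) u u'.
  have h3 := linisom_dist (rho (gam q.+1)) u u'.
  have -> : rho (gam q) u - rho (gam q.+1) u =
    (rho (gam q) u - rho (gam q) u') + (rho (gam q) u' - rho (gam q.+1) u')
    - (rho (gam q.+1) u - rho (gam q.+1) u').
    by rewrite addrA subrK opprB addrA subrK.
  apply: le_trans (ler_normB _ _) _; rewrite h3.
  by have := ler_normD (rho (gam q) u - rho (gam q) u')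
    (rho (gam q) u' - rho (gam q.+1) u'); rewrite h2; lra.
have start : `|rho (gam 0%N) u - u| <= e1.
  rewrite -[X in _ - X]rep1.
  apply: (rep_hull_agree d'0 sd' s'x _ hu) => m i /= mN.
  by rewrite hP gamP ?ltn_addr // /lev mN.
have steps q : `|rho (gam q) u - u| <= e1 + 3 * e1 * q%:R.
  elim: q => [|q IHq]; first by rewrite mulr0 addr0.
  have -> : rho (gam q.+1) u - u =
    (rho (gam q) u - u) - (rho (gam q) u - rho (gam q.+1) u).
    by rewrite opprB [RHS]addrC addrA subrK.
  apply: le_trans (ler_normB _ _) _; rewrite -natr1.
  by have := step q; lra.
pose g := gam k.*2.
have k2 : (k.*2)%:R = k%:R *+ 2 :> R by rewrite -muln2 natrM mulr_natr.
have gu : `|rho g u - u| <= 4 * e.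
  apply: le_trans (steps k.*2) _; rewrite k2 mulrnAr -mulrA.
  have : e1 <= e1 * k%:R by rewrite ler_peMr ?(ltW e10) // ler1n.
  by move: e1k; rewrite !mulr2n; lra.
have gv : `|rho g v - v| <= 6 * e.
  have -> : rho g v - v = (rho g u - u) - (rho g u - rho g v) + (u - v).
    rewrite opprB [X in _ = X + _]addrC.
    by rewrite (addrA (rho g v - _)) subrK addrA subrK.
  apply: le_trans (ler_normD _ _) _.
  by have := ler_normB (rho g u - u) (rho g u - rho g v);
    rewrite linisom_dist; lra.
have gx : {in s &, forall a b, mdist (g a) b = mdist a b + t}.
  move=> _ _ /sx[i ->] /sx[j ->].
  have -> : g (x i) = c k.*2 0%N i.
    by rewrite -[X in g X]c0 /g gamP ?ltn_addr // /lev N0 odd_double doubleK.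
  rewrite -[X in mdist _ X = _]c0 cD eqxx subn0 sub0n addn0 max0n k2.
  by rewrite mulrnAr rk.
(* Both f and g take s to a parallel copy at distance t; hence some isometry kap
   fixes s pointwise and carries the copy made by g to the copy made by f. *)
have [|kap kapP] := @urysohn_homogeneous _ _ U_urysohn _
  (enum {: bool * seq_sub s})
  (fun p => if p.1 then ssval p.2 else g (ssval p.2))
  (fun p => if p.1 then ssval p.2 else f (ssval p.2)).
  move=> [b a] [b' a'] _ _; have sa := ssvalP a; have sa' := ssvalP a'.
  case: b; case: b' => //=.
  - by rewrite ![mdist (ssval a) _]metric_sym ft // gx.
  - by rewrite ft // gx.
  - by rewrite !isom_isometric.
have kapv : `|rho kap v - v| < e.
  rewrite -[X in _ - X]rep1; apply: (rep_eq_on d0 sd) => a sa.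
  by apply: (kapP (true, SeqSub sa)); rewrite mem_enum.
have fv : `|rho f v - rho (kap * g)%g v| < e.
  apply: (rep_eq_on d0 sd) => a sa; apply/esym.
  by apply: (kapP (false, SeqSub sa)); rewrite mem_enum.
have -> : rho f v - v = (rho f v - rho (kap * g)%g v)
  + (rho kap (rho g v) - rho kap v) + (rho kap v - v).
  by rewrite repM (addrA (rho f v - _)) subrK addrA subrK.
apply: le_trans (ler_normD _ _) _.
have := ler_normD (rho f v - rho (kap * g)%g v) (rho kap (rho g v) - rho kap v).
by rewrite linisom_dist; lra.
Qed.

(** As D is at least the diameter of s, there is a copy of s that is parallel at
distance D / 2 to s and to its image by f. *)
Lemma equidistant_move s d v e (D : R) (f : isom U) : 0 < e -> 0 < d -> 0 < D ->
  moves_little_near s d v e ->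
  {in s &, forall a b, mdist a b <= D} ->
  {in s &, forall a b, mdist (f a) b = D} ->
  `|rho f v - v| <= 16 * e.
Proof.
move=> e0 d0 D0 sd sD fD.
pose I : finType := seq_sub s; pose x (i : I) : U := ssval i.
pose z (p : bool * I) := if p.1 then x p.2 else f (x p.2).
have xD i j : mdist (x i) (x j) <= D by apply: sD; exact: ssvalP.
have fxD i j : mdist (f (x i)) (x j) = D by apply: fD; exact: ssvalP.
have [||||g gP] := @urysohn_move _ _ U_urysohn I (bool * I)%type x z
  (fun i p => mdist (x i) (x p.2) + D / 2).
- move=> i [b j] [b' k]; rewrite /z /=.
  case: b; case: b' => /=; rewrite ?[mdist (x _) (f _)]metric_sym
    ?isom_isometric ?fxD.
  + by have := metric_triangle (x i) (x k) (x j); lra.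
  + by have := xD i j; have := mdist_ge0 (x i) (x k); lra.
  + by have := xD i j; have := mdist_ge0 (x i) (x k); lra.
  + by have := metric_triangle (x i) (x k) (x j); lra.
- move=> i [b j] [b' k]; rewrite /z /=.
  have := mdist_ge0 (x i) (x k); have := mdist_ge0 (x i) (x j).
  have := xD j k.
  case: b; case: b' => /=; rewrite ?[mdist (x _) (f _)]metric_sym
    ?isom_isometric ?fxD; lra.
- by move=> i [b j] k /=; have := metric_triangle (x i) (x k) (x j); lra.
- move=> i [b j] k /=; have := metric_triangle (x i) (x j) (x k).
  by rewrite (metric_sym (x j)); lra.
have D2 : 0 < D / 2 by rewrite divr_gt0.
have gv : `|rho g v - v| <= 8 * e.
  apply: (parallel_move e0 d0 D2 sd) => a b sa sb.
  exact: (gP (SeqSub sa) (true, SeqSub sb)).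
have fg : `|rho g v - rho f v| <= 8 * e.
  rewrite rep_dist; apply: (parallel_move e0 d0 D2 sd) => a b sa sb.
  rewrite -(isom_isometric f).
  have -> : f ((f^-1 * g)%g a) = g a by exact: (isom_inv_funK f (g a)).
  exact: (gP (SeqSub sa) (false, SeqSub sb)).
have -> : rho f v - v = (rho g v - v) - (rho g v - rho f v).
  by rewrite opprB [RHS]addrC addrA subrK.
by apply: le_trans (ler_normB _ _) _; lra.
Qed.

(** There is a copy of s all of whose points are at a large distance D from all
points of s and of its image by g. *)
Lemma rep_moves_little s d v e g : 0 < e -> 0 < d -> moves_little_near s d v e ->
  `|rho g v - v| <= 32 * e.
Proof.
move=> e0 d0 sd.
pose I : finType := seq_sub s; pose x (i : I) : U := ssval i.
pose z (p : bool * I) := if p.1 then x p.2 else g (x p.2).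
pose D : R := 1 + \sum_p \sum_q mdist (z p) (z q).
have zD p q : mdist (z p) (z q) <= D.
  rewrite /D (bigD1 p) //= (bigD1 q) //=.
  have h1 : 0 <= \sum_(i | i != q) mdist (z p) (z i).
    by apply: sumr_ge0 => i _; exact: mdist_ge0.
  have h2 : 0 <= \sum_(i | i != p) \sum_q mdist (z i) (z q).
    by apply: sumr_ge0 => i _; apply: sumr_ge0 => j _; exact: mdist_ge0.
  lra.
have D0 : 0 < D.
  rewrite ltr_pwDl // sumr_ge0 // => i _.
  by apply: sumr_ge0 => j _; exact: mdist_ge0.
have sD : {in s &, forall a b, mdist a b <= D}.
  by move=> a b sa sb; exact: (zD (true, SeqSub sa) (true, SeqSub sb)).
have [||||f fP] := @urysohn_move _ _ U_urysohn I (bool * I)%type x z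
  (fun i p => D).
- by move=> i p q; rewrite lerDl mdist_ge0.
- by move=> i p q; rewrite (le_trans (zD p q)) // lerDl ltW.
- by move=> i p k; rewrite lerDr mdist_ge0.
- by move=> i _ k; rewrite (le_trans (zD (true, i) (true, k))) // lerDl ltW.
have fv : `|rho f v - v| <= 16 * e.
  apply: (equidistant_move e0 d0 D0 sd sD) => a b sa sb.
  exact: (fP (SeqSub sa) (true, SeqSub sb)).
have fg : `|rho f v - rho g v| <= 16 * e.
  rewrite rep_dist; apply: (equidistant_move e0 d0 D0 sd sD) => a b sa sb.
  rewrite -(isom_isometric g).
  have -> : g ((g^-1 * f)%g a) = f a by exact: (isom_inv_funK g (f a)).
  exact: (fP (SeqSub sa) (false, SeqSub sb)).
have -> : rho g v - v = (rho f v - v) - (rho f v - rho g v).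
  by rewrite opprB [RHS]addrC addrA subrK.
by apply: le_trans (ler_normB _ _) _; lra.
Qed.

End Representation.

Theorem corollary6p3 (R : realType) (U : metricType R)
    (U_urysohn : urysohn U)
    (E : completeNormedModType R) (E_reflexive : reflexive_space E)
    (rho : {multiplicative isom U -> linisom E}) :
  continuous (rho : isom U -> linisom E) ->
  forall g : isom U, rho g = 1%g.
Proof.
move=> rhoc g; apply: linisom_ext => v; rewrite [RHS]/=.
apply/eqP; rewrite -subr_eq0 -normr_le0; apply/ler_addgt0Pr => e e0.
have e32 : 0 < e / 32 by rewrite divr_gt0.
have [s [d d0 sd]] := rep_continuous_at1 v rhoc e32.
have := rep_moves_little U_urysohn E_reflexive rhoc g e32 d0 sd; lra.
Qed.
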